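(* Let $\mathsf{K}\in\mathbb{K}$ and $T\in\mathrm{GL}_n$. Then $$J(\mathscr{T}_T(\mathsf{K}))=\mathrm{Tr}\left(P_{\mathsf{K}}\,\bar T^{-1}X\,\bar T^{-\mathsf T}\right),\qquad \bar T:=\begin{bmatrix} I_n&0\\ 0&T\end{bmatrix},$$ where $P_{\mathsf{K}}$ is the unique positive semidefinite solution of the Lyapunov equation $$P_{\mathsf K}=\bar Q+\bar C^{\mathsf T}\mathsf K^{\mathsf T}\bar R\mathsf K\bar C+(\bar A+\bar B\mathsf K\bar C)^{\mathsf T}P_{\mathsf K}(\bar A+\bar B\mathsf K\bar C),$$ and $X=\mathbb{E}_{\bar x_0\sim\bar{\mathcal D}}[\bar x_0\bar x_0^{\mathsf T}]$.
   Context: Fix $A\in\mathbb{R}^{n\times n}$, $B\in\mathbb{R}^{n\times m}$, $C\in\mathbb{R}^{d\times n}$, $Q\in\mathbb{R}^{n\times n}$ symmetric positive semidefinite and $R\in\mathbb{R}^{m\times m}$ symmetric positive definite. The system is $x_{t+1}=Ax_t+Bu_t$, $y_t=Cx_t$, controlled by the full-order dynamic controller $\xi_{t+1}=A_{\mathsf K}\xi_t+B_{\mathsf K}y_t$, $u_t=C_{\mathsf K}\xi_t$, with $A_{\mathsf K}\in\mathbb{R}^{n\times n}$, $B_{\mathsf K}\in\mathbb{R}^{n\times d}$, $C_{\mathsf K}\in\mathbb{R}^{m\times n}$. Controller parameters are collected as $\mathsf K=\begin{bmatrix}0_{m\times d}&C_{\mathsf K}\\ B_{\mathsf K}&A_{\mathsf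 K}\end{bmatrix}$. Put $$\bar A=\begin{bmatrix}A&0\\ 0&0\end{bmatrix},\ \bar B=\begin{bmatrix}B&0\\ 0&I_n\end{bmatrix},\ \bar C=\begin{bmatrix}C&0\\ 0&I_n\end{bmatrix},\ \bar Q=\begin{bmatrix}Q&0\\ 0&0_{n\times n}\end{bmatrix},\ \bar R=\begin{bmatrix}R&0\\ 0&0_{n\times n}\end{bmatrix},$$ so that $\bar A+\bar B\mathsf K\bar C=\begin{bmatrix}A&BC_{\mathsf K}\\ B_{\mathsf K}C&A_{\mathsf K}\end{bmatrix}$ is the closed-loop matrix for $\bar x_t=(x_t,\xi_t)$. $\mathbb{K}$ is the set of $\mathsf K$ of the block form $\begin{bmatrix}0_{m\times d}&C_{\mathsf K}\\ B_{\mathsf K}&A_{\mathsf K}\end{bmatrix}$ with spectral radius $\rho(\bar A+\bar B\mathsf K\bar C)<1$. The initial state $\bar x_0=(x_0,\xi_0)$ follows a fixed distribution $\bar{\mathcal D}$ (independent of $\mathsf K$) with finite second moments. The dLQR cost on $\mathbb{K}$ is $J(\mathsf K)=\mathbb{E}_{\bar x_0\sim\bar{\mathcal D}}\left[\sum_{t=0}^\infty (x_t^{\mathsf T}Qx_t+u_t^{\mathsf T}Ru_t)\right]=\mathrm{Tr}(P_{\mathsf K}X)$. $\mathrm{GL}_n$ is the set of invertible real $n\times n$ matrices, and for $T\in\mathrm{GL}_n$ the similarity transformation of $\mathsf K$ is $\mathscr{T}_T(\mathsf K)=\begin{bmatrix}0&C_{\mathsf K}T^{-1}\\ TB_{\mathsf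 K}&TA_{\mathsf K}T^{-1}\end{bmatrix}$. *)

(* Defs.v *)
From HB Require Import structures.
From mathcomp Require Import all_boot all_order all_algebra.
From mathcomp Require Import complex.
From mathcomp Require Import all_classical all_reals all_analysis.

Set Implicit Arguments.
Unset Strict Implicit.
Unset Printing Implicit Defensive.

Import Order.TTheory GRing.Theory Num.Theory.
Import numFieldNormedType.Exports.

Local Open Scope classical_set_scope.
Local Open Scope ring_scope.

Definition psd (F : realType) (k : nat) (M : 'M[F]_k) : Prop :=
  M^T = M /\ forall v : 'cV[F]_k, 0 <= (v^T *m M *m v) 0 0.

Definition posdef (F : realType) (k : nat) (M : 'M[F]_k) : Prop :=
  M^T = M /\ forall v : 'cV[F]_k, v != 0 -> 0 < (v^T *m M *m v) 0 0.

(* The set of moduli is finite, so [sup] is a maximum; it is 0 when k = 0. *)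
Definition spectral_radius (F : realType) (k : nat) (M : 'M[F]_k) : F :=
  sup [set ComplexField.Normc.normc z | z in
        [set z : F[i]%C | eigenvalue (map_mx (real_complex F) M) z]].

Definition borel_cV (F : realType) (k : nat) :=
  g_sigma_algebraType (@open 'cV[F]_k).

Section Controller.
Context {F : realType} {n m d : nat}.
Implicit Types (A : 'M[F]_n) (B : 'M[F]_(n, m)) (C : 'M[F]_(d, n)).
Implicit Types (Q : 'M[F]_n) (R : 'M[F]_m) (K : 'M[F]_(m + n, d + n)).
Implicit Types (D : probability (borel_cV F (n + n)) F).

Definition barA A : 'M[F]_(n + n) := block_mx A 0 0 0.
Definition barB B : 'M[F]_(n + n, m + n) := block_mx B 0 0 1%:M.
Definition barC C : 'M[F]_(d + n, n + n) := block_mx C 0 0 1%:M.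
Definition barQ Q : 'M[F]_(n + n) := block_mx Q 0 0 0.
Definition barR R : 'M[F]_(m + n) := block_mx R 0 0 0.
Definition barT (T : 'M[F]_n) : 'M[F]_(n + n) := block_mx 1%:M 0 0 T.

Definition ctrlC K : 'M[F]_(m, n) := ursubmx K.
Definition ctrlB K : 'M[F]_(n, d) := dlsubmx K.
Definition ctrlA K : 'M[F]_n := drsubmx K.

Definition closed_loop A B C K : 'M[F]_(n + n) :=
  barA A + barB B *m K *m barC C.

Definition stabilizing A B C : set 'M[F]_(m + n, d + n) :=
  [set K | ulsubmx K = 0 /\ spectral_radius (closed_loop A B C K) < 1].

Definition similarity (T : 'M[F]_n) K : 'M[F]_(m + n, d + n) :=
  block_mx 0                 (ctrlC K *m invmx T)
           (T *m ctrlB K)    (T *m ctrlA K *m invmx T).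

Definition ctrl_input K (xi : 'cV[F]_n) : 'cV[F]_m := ctrlC K *m xi.

Definition step A B C K (s : 'cV[F]_n * 'cV[F]_n) : 'cV[F]_n * 'cV[F]_n :=
  let: (x, xi) := s in
  (A *m x + B *m ctrl_input K xi, ctrlA K *m xi + ctrlB K *m (C *m x)).

Definition trajectory A B C K (x0 : 'cV[F]_(n + n)) (t : nat) :
    'cV[F]_n * 'cV[F]_n :=
  iter t (step A B C K) (usubmx x0, dsubmx x0).

Definition stage_cost Q R K (s : 'cV[F]_n * 'cV[F]_n) : F :=
  let: (x, xi) := s in
  let u := ctrl_input K xi in
  (x^T *m Q *m x) 0 0 + (u^T *m R *m u) 0 0.

(* Extended-real valued: for Q, R positive semidefinite the integrand is a
   series of nonnegative terms, so the value is meaningful (possibly +oo) for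
   every K and every D. *)
Definition dLQR_cost A B C Q R D K : \bar F :=
  (\int[D]_(x0 in setT)
     \sum_(0 <= t <oo) (stage_cost Q R K (trajectory A B C K x0 t))%:E)%E.

Definition finite_second_moments D : Prop :=
  forall i : 'I_(n + n),
    D.-integrable setT (fun x : 'cV[F]_(n + n) => (x i 0 ^+ 2)%:E).

Definition second_moment D : 'M[F]_(n + n) :=
  \matrix_(i, j) fine 'E_D[fun x : 'cV[F]_(n + n) => x i 0 * x j 0].

Definition lyapunov A B C Q R K (P : 'M[F]_(n + n)) : Prop :=
  P = barQ Q + (barC C)^T *m K^T *m barR R *m K *m barC C
      + (closed_loop A B C K)^T *m P *m closed_loop A B C K.

End Controller.

(* Main.v *)
Require Import Defs.
From HB Require Import structures.
From mathcomp Require Import all_boot all_order all_algebra.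
From mathcomp Require Import complex.
From mathcomp Require Import all_classical all_reals all_analysis.
From mathcomp Require Import measurable_realfun.

Set Implicit Arguments.
Unset Strict Implicit.
Unset Printing Implicit Defensive.

Import Order.TTheory GRing.Theory Num.Theory.
Import numFieldNormedType.Exports.
Local Open Scope classical_set_scope.
Local Open Scope ring_scope.

(** Write [M] for the closed-loop matrix of [K] and [W] for its stage weight, so
    that the cost of a closed-loop state [v] is the quadratic form of [W] at [v].

    All the analysis rests on one fact: if the spectral radius of [M] is below
    one, then [M ^+ t] tends to zero ([powers_cvg0]).  It is obtained without a
    normal form: the characteristic polynomial splits over the complex numbers,
    and its linear factors are removed one by one, each of them amounting to a
    scalar recursion [a (t + 1) = z * a t + e t] with [z] of modulus below one
    and [e] tending to zero.

    A solution [P] of [P = M^T P M] equals [(M ^+ t)^T P M ^+ t] for every [t],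
    hence vanishes; so the Lyapunov equation has at most one solution, and
    therefore exactly one, being linear on a finite-dimensional space.  Its
    solution satisfies [qform P v = qform W v + qform P (M v)], so the costs
    along the orbit of [v] telescope and their series sums to [qform P v]
    ([series_qform_orbit]).  In particular [P] is positive semidefinite.

    The controller [similarity T K] started at [x0] produces the trajectory of
    [K] started at [invmx (barT T) *m x0], up to the coordinates of the
    controller state, with the same inputs and hence the same costs.  Its cost
    is thus [qform P (invmx (barT T) *m x0)], pointwise in [x0], and no
    interchange of series and integral is involved.  The expectation of a
    quadratic form is a trace against the matrix of second moments
    ([integral_qform]), which are finite because
    [2 * |x i * x j| <= x i ^+ 2 + x j ^+ 2]. *)

(** * Powers of a matrix of spectral radius below one *)

(** Comparison with the stable scalar recursion: from the time when
    [e t <= (1 - r) * c], the distance of [u] above the level [c] shrinks by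
    the factor [r] at each step. *)
Lemma contraction_cvg0 (F : realType) (r : F) (u e : nat -> F) :
  0 <= r < 1 -> (forall t, 0 <= u t) ->
  (forall t, u t.+1 <= r * u t + e t) ->
  e t @[t --> \oo] --> 0 -> u t @[t --> \oo] --> 0.
Proof.
move=> /andP[r0 r1] u0 urec e0; apply/cvgrPdist_lt => eps eps0.
(* The level [c] stands for half of [eps], the transient for the other half. *)
pose c := eps / 2.
have c0 : 0 < c by rewrite divr_gt0.
have rc0 : 0 < (1 - r) * c by rewrite mulr_gt0 // subr_gt0.
have /cvgrPdist_lt/(_ _ rc0)[N _ eN] := e0.
have ubound k : u (N + k)%N <= r ^+ k * u N + c.
  elim: k => [|k IHk]; first by rewrite addn0 expr0 mul1r lerDl ltW.
  rewrite addnS (le_trans (urec _)) //.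
  have eNk : e (N + k)%N <= (1 - r) * c.
    apply: le_trans (ler_norm _) _; apply: ltW.
    by have := eN (N + k)%N (leq_addr _ _); rewrite /= sub0r normrN.
  apply: le_trans (lerD (ler_wpM2l r0 IHk) eNk) _.
  by rewrite mulrDr mulrA -exprS -addrA -mulrDl addrC subrKC mul1r addrC.
have rcvg : r ^+ t * u N @[t --> \oo] --> 0.
  rewrite -[X in _ --> X](mul0r (u N)); apply: cvgM; last exact: cvg_cst.
  by apply: cvg_expr; rewrite ger0_norm.
have /cvgrPdist_lt/(_ _ c0)[N' _ rN'] := rcvg.
exists (N + N')%N => // t /= ltt.
rewrite sub0r normrN ger0_norm //.
have Nt : (N <= t)%N by rewrite (leq_trans _ ltt) ?leq_addr.
rewrite -(subnKC Nt) (le_lt_trans (ubound _)) // [ltRHS](splitr eps) ltrD2r.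
apply: le_lt_trans (ler_norm _) _.
have := rN' (t - N)%N; rewrite /= sub0r normrN; apply.
by rewrite leq_subRL.
Qed.

Definition entrywise_cvg (F : realType) (p q : nat)
    (U : nat -> 'M[F]_(p, q)) (L : 'M[F]_(p, q)) : Prop :=
  forall i j, U t i j @[t --> \oo] --> L i j.

Section EntrywiseConvergence.
Context {F : realType} {p q : nat}.

Lemma entrywise_cvg_cst (L : 'M[F]_(p, q)) : entrywise_cvg (fun=> L) L.
Proof. by move=> i j; exact: cvg_cst. Qed.

Lemma entrywise_cvg_tr (U : nat -> 'M[F]_(p, q)) L :
  entrywise_cvg U L -> entrywise_cvg (fun t => (U t)^T) L^T.
Proof.
move=> UL i j; rewrite mxE.
by under eq_fun do rewrite mxE; exact: UL.
Qed.

Lemma entrywise_cvg_mul r (U : nat -> 'M[F]_(p, q)) (V : nat -> 'M[F]_(q, r))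
    L L' :
  entrywise_cvg U L -> entrywise_cvg V L' ->
  entrywise_cvg (fun t => U t *m V t) (L *m L').
Proof.
move=> UL VL' i j; rewrite mxE.
under eq_fun do rewrite mxE.
apply: cvg_big; first exact: add_continuous.
by move=> k _; apply: cvgM; [exact: UL | exact: VL'].
Qed.

End EntrywiseConvergence.

Arguments entrywise_cvg_cst {F p q} L.

(** Peeling off one root [z] at a time: [Y' = (M - z) Y] is annihilated by the
    remaining factors, and the entries of [M ^+ t * Y] satisfy the recursion
    [a (t + 1) = z * a t + (M ^+ t * Y') i j]. *)
Lemma annihilated_powers_cvg0 (F : realType) (k : nat) (M : 'M[F[i]]_k.+1)
    (rs : seq F[i]) (Y : 'M[F[i]]_k.+1) :
  (forall z, z \in rs -> ComplexField.Normc.normc z < 1) ->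
  horner_mx M (\prod_(z <- rs) ('X - z%:P)) * Y = 0 ->
  forall i j,
    ComplexField.Normc.normc ((M ^+ t * Y) i j) @[t --> \oo] --> (0 : F).
Proof.
elim: rs Y => [|z rs IHrs] Y rs1 MY0 i j.
  move: MY0; rewrite big_nil rmorph1 mul1r => ->.
  under eq_fun do rewrite mulr0 mxE ComplexField.Normc.normc0.
  exact: cvg_cst.
pose Y' := (M - z%:M) * Y.
have Y'0 : horner_mx M (\prod_(z <- rs) ('X - z%:P)) * Y' = 0.
  rewrite -MY0 big_cons [X in _ = horner_mx M X * _]mulrC rmorphM /= rmorphB /=.
  by rewrite horner_mx_X horner_mx_C -mulrA.
have rs1' w : w \in rs -> ComplexField.Normc.normc w < 1.
  by move=> wrs; apply: rs1; rewrite inE wrs orbT.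
apply: (contraction_cvg0 (r := ComplexField.Normc.normc z) _ _ _
  (IHrs Y' rs1' Y'0 i j)).
- rewrite rs1 ?mem_head // andbT.
  by case: (z) => a b; exact: sqrtr_ge0.
- by move=> t; case: (_ i j) => a b; exact: sqrtr_ge0.
- move=> t; rewrite -ComplexField.Normc.normcM.
  have -> : M ^+ t.+1 * Y = z *: (M ^+ t * Y) + M ^+ t * Y'.
    rewrite /Y' exprSr -mulrA mulrBl mulrBr.
    have -> : M ^+ t * (z%:M * Y) = z *: (M ^+ t * Y).
      by rewrite -[z%:M * Y]/(z%:M *m Y) mul_scalar_mx -scalerAr.
    by rewrite addrC subrK.
  rewrite mxE [X in X + _]mxE.
  exact: le_normcD.
Qed.

(** Over the complex numbers the characteristic polynomial splits, its roots
    are the eigenvalues, and it annihilates the matrix by Cayley-Hamilton. *)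
Lemma powers_cvg0 (F : realType) (k : nat) (M : 'M[F]_k) :
  spectral_radius M < 1 -> entrywise_cvg (fun t => M ^+ t) 0.
Proof.
case: k M => [M _ []//|k M rho1 i j].
pose Mc := map_mx (real_complex F) M.
have [rs Dchi] := closed_field_poly_normal (char_poly Mc).
rewrite (monicP (char_poly_monic Mc)) scale1r in Dchi.
have eigP z : eigenvalue Mc z = (z \in rs).
  by rewrite eigenvalue_root_char Dchi root_prod_XsubC.
have rs1 z : z \in rs -> ComplexField.Normc.normc z < 1.
  move=> zrs; apply: le_lt_trans rho1; apply: ub_le_sup; last first.
    by exists z => //=; rewrite eigP.
  (* Any bound on the moduli makes the supremum meaningful. *)
  exists (\sum_(w <- rs) ComplexField.Normc.normc w) => _ [w /= ew <-].
  rewrite eigP in ew; rewrite (big_rem _ ew) /= lerDl sumr_ge0 // => v _.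
  by case: v => a b; exact: sqrtr_ge0.
have := annihilated_powers_cvg0 (M := Mc) (Y := 1) rs1.
rewrite -Dchi Cayley_Hamilton mul0r => /(_ erefl i j) Mcvg.
rewrite mxE; apply/norm_cvg0P; move: Mcvg; apply: cvg_trans.
apply: near_eq_cvg; apply: nearW => t /=.
rewrite mulr1 /Mc -rmorphXn /= mxE /=.
by rewrite expr0n addr0 sqrtr_sqr.
Qed.

(** * The discrete Lyapunov equation of a stable matrix *)

Definition qform (F : realType) (k : nat) (P : 'M[F]_k) (v : 'cV[F]_k) : F :=
  (v^T *m P *m v) 0 0.

Lemma qformD (F : realType) k (P P' : 'M[F]_k) v :
  qform (P + P') v = qform P v + qform P' v.
Proof. by rewrite /qform mulmxDr mulmxDl mxE. Qed.

Lemma qform_mul (F : realType) k l (S : 'M[F]_(k, l)) P (v : 'cV[F]_l) :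
  qform P (S *m v) = qform (S^T *m P *m S) v.
Proof. by rewrite /qform trmx_mul !mulmxA. Qed.

Section Lyapunov.
Context {F : realType} {k : nat}.
Implicit Types (M W P : 'M[F]_k) (v : 'cV[F]_k).

Lemma iterated_fixpoint M P t :
  P = M^T *m P *m M -> P = (M ^+ t)^T *m P *m M ^+ t.
Proof.
move=> PM; elim: t => [|t IHt]; first by rewrite trmx1 mul1mx mulmx1.
rewrite exprS -[M * _]/(M *m _) trmx_mul.
have -> : (M ^+ t)^T *m M^T *m P *m (M *m M ^+ t) =
    (M ^+ t)^T *m (M^T *m P *m M) *m M ^+ t by rewrite !mulmxA.
by rewrite -PM.
Qed.

(** [P] is the constant sequence [(M ^+ t)^T *m P *m M ^+ t], which tends to
    zero. *)
Lemma lyapunov_homogeneous M P :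
  entrywise_cvg (fun t => M ^+ t) 0 -> P = M^T *m P *m M -> P = 0.
Proof.
move=> M0 PM; apply/matrixP => i j.
have := entrywise_cvg_mul
  (entrywise_cvg_mul (entrywise_cvg_tr M0) (entrywise_cvg_cst P)) M0.
move=> /(_ i j); rewrite mulmx0.
under eq_fun do rewrite -(iterated_fixpoint _ PM).
move=> PO; exact: (cvg_unique _ (cvg_cst _) PO).
Qed.

Lemma lyapunov_unique M W P P' : entrywise_cvg (fun t => M ^+ t) 0 ->
  P = W + M^T *m P *m M -> P' = W + M^T *m P' *m M -> P' = P.
Proof.
move=> M0 PM PM'; apply/subr0_eq/(lyapunov_homogeneous M0).
by rewrite mulmxBr mulmxBl {1}PM {1}PM' opprD addrACA subrr add0r.
Qed.

Definition lyapunov_defect M P : 'M[F]_k := P - M^T *m P *m M.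

Lemma lyapunov_defect_is_linear M : linear (lyapunov_defect M).
Proof.
move=> a X Y; rewrite /lyapunov_defect mulmxDr mulmxDl -scalemxAr -scalemxAl.
by rewrite scalerBr opprD addrACA.
Qed.

HB.instance Definition _ M :=
  GRing.isLinear.Build F 'M[F]_k 'M[F]_k _ (lyapunov_defect M)
    (lyapunov_defect_is_linear M).

(** The matrix equation is linear on a finite-dimensional space, so that
    uniqueness yields existence. *)
Lemma lyapunov_exists M W : entrywise_cvg (fun t => M ^+ t) 0 ->
  exists P, P = W + M^T *m P *m M.
Proof.
move=> M0; pose f : 'End('M[F]_k) := linfun (lyapunov_defect M).
have finj : lker f == 0%VS.
  apply/lker0P => X Y; rewrite !lfunE /= => XY.
  apply/subr0_eq/(lyapunov_homogeneous M0)/subr0_eq.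
  by rewrite -[LHS]/(lyapunov_defect M (X - Y)) linearB /= XY subrr.
exists (f^-1%VF W); have := lker0_lfunVK finj W.
by rewrite lfunE /= /lyapunov_defect => /eqP; rewrite subr_eq => /eqP.
Qed.

Lemma qform_powers_cvg0 M P v : entrywise_cvg (fun t => M ^+ t) 0 ->
  qform P (M ^+ t *m v) @[t --> \oo] --> 0.
Proof.
move=> M0; have Mv0 := entrywise_cvg_mul M0 (entrywise_cvg_cst v).
have := entrywise_cvg_mul
  (entrywise_cvg_mul (entrywise_cvg_tr Mv0) (entrywise_cvg_cst P)) Mv0.
by move=> /(_ 0 0); rewrite mul0mx mulmx0 mxE.
Qed.

(** Along the orbit of [v] the form [qform P] loses [qform W] at each step,
    hence the stage costs telescope. *)
Lemma sum_qform_orbit M W P v t : P = W + M^T *m P *m M ->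
  \sum_(0 <= s < t) qform W (M ^+ s *m v) = qform P v - qform P (M ^+ t *m v).
Proof.
move=> PM; have step s : qform W (M ^+ s *m v) =
    - qform P (M ^+ s.+1 *m v) - - qform P (M ^+ s *m v).
  rewrite exprS -[M * _]/(M *m _) -mulmxA (qform_mul M P) opprK.
  by rewrite addrC {1}PM qformD addrK.
rewrite (eq_bigr _ (fun s _ => step s)) telescope_sumr // expr0 mul1mx opprK.
by rewrite addrC.
Qed.

Lemma series_qform_orbit M W P v : entrywise_cvg (fun t => M ^+ t) 0 ->
  P = W + M^T *m P *m M ->
  \sum_(0 <= s < t) qform W (M ^+ s *m v) @[t --> \oo] --> qform P v.
Proof.
move=> M0 PM; under eq_fun do rewrite (sum_qform_orbit _ _ PM).
suff : qform P v - qform P (M ^+ t *m v) @[t --> \oo] --> qform P v - 0.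
  by rewrite subr0.
by apply: cvgB; [exact: cvg_cst | exact: qform_powers_cvg0].
Qed.

(** Symmetry follows from uniqueness, [P^T] being a solution as well; the sign
    from the nonnegative series that sums to [qform P v]. *)
Lemma lyapunov_psd M W P : entrywise_cvg (fun t => M ^+ t) 0 -> psd W ->
  P = W + M^T *m P *m M -> psd P.
Proof.
move=> M0 [Wsym W0] PM; split.
  apply: (lyapunov_unique M0 PM).
  by rewrite {1}PM linearD /= Wsym !trmx_mul trmxK mulmxA.
move=> v; have cvgP := series_qform_orbit (v := v) M0 PM.
rewrite -[leRHS]/(qform P v) -(cvg_lim (@Rhausdorff _) cvgP).
apply: limr_ge; first by apply/cvg_ex; exists (qform P v).
by apply: nearW => t; apply: sumr_ge0 => s _; exact: W0.
Qed.

End Lyapunov.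

(** * Closed-loop trajectories *)

Section ClosedLoop.
Context {F : realType} {n m d : nat}.
Implicit Types (A : 'M[F]_n) (B : 'M[F]_(n, m)) (C : 'M[F]_(d, n)).
Implicit Types (Q T : 'M[F]_n) (R : 'M[F]_m) (K : 'M[F]_(m + n, d + n)).
Implicit Types (s : 'cV[F]_n * 'cV[F]_n).

Definition stage_weight C Q R K : 'M[F]_(n + n) :=
  barQ Q + (barC C)^T *m K^T *m barR R *m K *m barC C.

Lemma qform_block_ul p q (S : 'M[F]_p) (u : 'cV[F]_p) (w : 'cV[F]_q) :
  qform (block_mx S 0 0 0) (col_mx u w) = qform S u.
Proof.
rewrite /qform tr_col_mx mul_row_block !mulmx0 !addr0 mul_row_col.
by rewrite mul0mx addr0.
Qed.

(** The upper block of [K *m barC C] applied to the joint state is the input: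
    since [K] has no direct feedthrough, [barR R] therefore weighs the input
    alone. *)
Lemma controller_action C K x xi : ulsubmx K = 0 ->
  K *m barC C *m col_mx x xi =
  col_mx (ctrl_input K xi) (ctrlB K *m (C *m x) + ctrlA K *m xi).
Proof.
move=> K0; rewrite -mulmxA -[K in LHS]submxK K0.
rewrite mul_block_col !mul0mx add0r addr0 mul1mx.
by rewrite mul_block_col mul0mx add0r.
Qed.

Lemma stage_costE C Q R K s : ulsubmx K = 0 ->
  stage_cost Q R K s = qform (stage_weight C Q R K) (col_mx s.1 s.2).
Proof.
case: s => x xi K0; rewrite /stage_weight qformD qform_block_ul.
have -> : (barC C)^T *m K^T *m barR R *m K *m barC C =
    (K *m barC C)^T *m barR R *m (K *m barC C) by rewrite trmx_mul !mulmxA.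
by rewrite -qform_mul (controller_action _ _ _ K0) qform_block_ul.
Qed.

Lemma stepE A B C K s : ulsubmx K = 0 ->
  col_mx (step A B C K s).1 (step A B C K s).2 =
  closed_loop A B C K *m col_mx s.1 s.2.
Proof.
case: s => x xi K0 /=; rewrite mulmxDl -!mulmxA (mulmxA K).
rewrite (controller_action _ _ _ K0) !mul_block_col !mul0mx !addr0 add0r.
by rewrite mul1mx add_col_mx add0r [X in col_mx _ X]addrC.
Qed.

Lemma trajectoryE A B C K x0 t : ulsubmx K = 0 ->
  col_mx (trajectory A B C K x0 t).1 (trajectory A B C K x0 t).2 =
  closed_loop A B C K ^+ t *m x0.
Proof.
move=> K0; elim: t => [|t IHt]; first by rewrite expr0 mul1mx vsubmxK.
by rewrite [trajectory _ _ _ _ _ _]iterS stepE // IHt exprS mulmxA.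
Qed.

Lemma stage_weight_psd C Q R K : psd Q -> posdef R ->
  ulsubmx K = 0 -> psd (stage_weight C Q R K).
Proof.
move=> [Qsym Q0] [Rsym R0] K0; split.
  rewrite /stage_weight linearD /= !trmx_mul !trmxK !tr_block_mx.
  by rewrite Qsym Rsym !trmx0 !mulmxA.
move=> v; rewrite -[leRHS]/(qform _ v) -(vsubmxK v).
rewrite -(stage_costE C Q R (usubmx v, dsubmx v) K0) addr_ge0 //.
have [->|u0] := eqVneq (ctrl_input K (dsubmx v)) 0; last exact/ltW/R0.
by rewrite trmx0 !mul0mx mxE.
Qed.

(** The change of coordinates [T] of the controller state turns the closed loop
    of [K] into that of [similarity T K], at equal inputs. *)
Definition state_change T s : 'cV[F]_n * 'cV[F]_n := (s.1, T *m s.2).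

Lemma ctrl_input_similarity T K xi : T \in unitmx ->
  ctrl_input (similarity T K) (T *m xi) = ctrl_input K xi.
Proof.
by move=> uT; rewrite /ctrl_input /ctrlC block_mxKur -mulmxA mulKmx.
Qed.

Lemma step_similarity A B C K T s : T \in unitmx ->
  step A B C (similarity T K) (state_change T s) =
  state_change T (step A B C K s).
Proof.
case: s => x xi uT; rewrite /state_change /= ctrl_input_similarity //.
congr pair; rewrite /ctrlA /ctrlB block_mxKdr block_mxKdl.
by rewrite -!mulmxA mulKmx // mulmxDr.
Qed.

Lemma stage_cost_similarity Q R K T s : T \in unitmx ->
  stage_cost Q R (similarity T K) (state_change T s) = stage_cost Q R K s.
Proof. by case: s => x xi uT; rewrite /= ctrl_input_similarity. Qed.

Lemma barT_unit T : T \in unitmx -> barT T \in unitmx.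
Proof. by rewrite !unitmxE (det_ublock 1%:M 0 T) det1 mul1r. Qed.

Lemma trajectory_similarity A B C K T x0 t : T \in unitmx ->
  trajectory A B C (similarity T K) x0 t =
  state_change T (trajectory A B C K (invmx (barT T) *m x0) t).
Proof.
move=> uT; elim: t => [|t IHt]; last by rewrite /= IHt step_similarity.
rewrite /trajectory /state_change /=; set v := invmx _ *m x0.
have -> : x0 = col_mx (usubmx v) (T *m dsubmx v).
  rewrite -[LHS](mulKVmx (barT_unit uT)) -/v -{1}(vsubmxK v) mul_block_col.
  by rewrite !mul0mx mul1mx addr0 add0r.
by rewrite col_mxKu col_mxKd.
Qed.

(** In the coordinates of [K] the controller [similarity T K] starts from
    [invmx (barT T) *m x0], and the transformed system has the same costs. *)
Lemma series_stage_cost_similarity A B C Q R K T P x0 :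
  stabilizing A B C K -> T \in unitmx -> lyapunov A B C Q R K P ->
  (\sum_(0 <= t <oo)
     (stage_cost Q R (similarity T K)
        (trajectory A B C (similarity T K) x0 t))%:E)%E =
  (qform P (invmx (barT T) *m x0))%:E.
Proof.
move=> [K0 rho1] uT PL; apply/cvg_lim => //.
apply: cvg_EFin; first by apply: nearW => t; rewrite sumEFin.
have := series_qform_orbit (v := invmx (barT T) *m x0) (powers_cvg0 rho1) PL.
apply: cvg_trans; apply: near_eq_cvg; apply: nearW => t /=.
rewrite sumEFin /=; apply: eq_bigr => s _.
by rewrite trajectory_similarity // stage_cost_similarity // -trajectoryE //
  (stage_costE C).
Qed.

End ClosedLoop.

(** * Expectation of a quadratic form *)

Section SecondMoments.
Context {F : realType} {n : nat}.
Variable D : probability (borel_cV F (n + n)) F.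
Hypothesis hD : finite_second_moments D.

(** Open intervals generate the Borel sets of the line, and their preimages under
    a continuous coordinate are open. *)
Lemma coord_measurable (k : nat) (i : 'I_k) :
  measurable_fun setT (fun x : borel_cV F k => (x : 'cV[F]_k) i 0).
Proof.
apply: (measurability _ (RGenOpens.measurableE F)).
move=> _ [_ [a [b ->] <-]]; rewrite setTI; apply: sub_sigma_algebra => /=.
have /continuousP := @coord_continuous F k 1 i 0.
by apply; exact: interval_open.
Qed.

Lemma coord_mul_integrable (i j : 'I_(n + n)) :
  D.-integrable setT
    (fun x : borel_cV F (n + n) =>
       ((x : 'cV[F]_(n + n)) i 0 * (x : 'cV[F]_(n + n)) j 0)%:E).
Proof.
apply: (le_integrable _ _ _ (integrableD measurableT (hD i) (hD j))) => //.
  apply/measurable_EFinP.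
  by apply: measurable_funM; exact: coord_measurable.
move=> x _ /=; rewrite lee_fin normrM.
set a := _ i 0; set b := _ j 0.
(* AM-GM for the absolute values, from the square of their difference. *)
rewrite [leRHS]ger0_norm ?addr_ge0 ?sqr_ge0 //.
rewrite -(real_normK (num_real a)) -(real_normK (num_real b)).
have := sqr_ge0 (`|a| - `|b|); rewrite sqrrB addrAC subr_ge0; apply: le_trans.
by rewrite mulr2n lerDl mulr_ge0.
Qed.

Lemma integral_qform (G : 'M[F]_(n + n)) :
  (\int[D]_(x in setT) (qform G (x : 'cV[F]_(n + n)))%:E)%E =
  (\tr (G *m second_moment D))%:E.
Proof.
have qformE (x : 'cV[F]_(n + n)) :
    (qform G x)%:E = (\sum_i \sum_j (G i j)%:E * (x j 0 * x i 0)%:E)%E.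
  rewrite /qform -mulmxA mxE -sumEFin; apply: eq_bigr => i _.
  rewrite mxE mxE mulr_sumr -sumEFin; apply: eq_bigr => j _.
  by rewrite -EFinM mulrCA [X in _ * X]mulrC.
under eq_integral do rewrite qformE.
rewrite integral_sum //; last first.
  move=> i; apply: integrable_sum => // j _.
  by apply: integrableZl => //; exact: coord_mul_integrable.
rewrite /mxtrace -sumEFin; apply: eq_bigr => i _.
rewrite integral_sum //; last first.
  by move=> j; apply: integrableZl => //; exact: coord_mul_integrable.
rewrite mxE -sumEFin; apply: eq_bigr => j _.
rewrite integralZl //; last exact: coord_mul_integrable.
rewrite !mxE EFinM unlock fineK //.
by apply: integrable_fin_num => //; exact: coord_mul_integrable.
Qed.

End SecondMoments.

(** * The cost of a similar controller *)

Theorem proposition1 (F : realType) (n m d : nat)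
    (A : 'M[F]_n) (B : 'M[F]_(n, m)) (C : 'M[F]_(d, n))
    (Q : 'M[F]_n) (R : 'M[F]_m) (hQ : psd Q) (hR : posdef R)
    (D : probability (borel_cV F (n + n)) F) (hD : finite_second_moments D)
    (K : 'M[F]_(m + n, d + n)) (hK : stabilizing A B C K)
    (T : 'M[F]_n) (hT : T \in unitmx) :
  exists P : 'M[F]_(n + n),
    [/\ psd P,
        lyapunov A B C Q R K P,
        forall P' : 'M[F]_(n + n), psd P' -> lyapunov A B C Q R K P' -> P' = P
      & dLQR_cost A B C Q R D (similarity T K) =
        (\tr (P *m invmx (barT T) *m second_moment D
                *m (invmx (barT T))^T))%:E].
Proof.
have [K0 rho1] := hK; have M0 := powers_cvg0 rho1.
have [P PL] := lyapunov_exists (stage_weight C Q R K) M0.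
exists P; split=> //.
- exact: lyapunov_psd M0 (stage_weight_psd C hQ hR K0) PL.
- by move=> P' _ PL'; exact: lyapunov_unique M0 PL PL'.
rewrite /dLQR_cost.
under eq_integral do rewrite (series_stage_cost_similarity _ hK hT PL) qform_mul.
rewrite integral_qform // -!mulmxA mxtrace_mulC.
by rewrite -!mulmxA.
Qed.
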